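(* Let $\mathcal{G}_n=\mathcal{G}(\mathcal{X}_n\cup\{S,T\};r_n)$ be a random geometric graph with $r_n=\omega(1)\left(\frac{\log n}{n}\right)^{1/d}$. Then $\mathcal{G}_n$ contains a monotone path $\vec\sigma_n\in \Sigma(S,T)$ such that $\mathcal{M}(\vec\sigma_n)=(1+o(1))\mathcal{M}(\vec\sigma^* )$, almost surely.
   Context: Fix a dimension $d\geq 2$. Let $\mathcal{M}:[0,1]^d\rightarrow \mathbb{R}$ be a cost map and $S,T\in[0,1]^d$ start and target points. $\Sigma(S,T)$ denotes the set of continuous paths $\sigma:[0,1]\rightarrow[0,1]^d$ with $\sigma(0)=S$, $\sigma(1)=T$, and the bottleneck cost of a path is $\mathcal{M}(\sigma)=\max_{\tau\in[0,1]}\mathcal{M}(\sigma(\tau))$. For $p=(p_1,\dots,p_d)$, $p'=(p'_1,\dots,p'_d)$, write $p\preceq p'$ if $p_i\leq p'_i$ for all $i$; a path $\sigma$ is monotone if $\sigma(\tau)\preceq\sigma(\tau')$ whenever $0\leq\tau\leq\tau'\leq 1$. For $x\preceq x'$, write $x\preceq_\delta x'$ when $\delta=\min_i\{x'_i-x_i\}$. Let $\mathcal{B}_r(x)$ be the Euclidean ball of radius $r$ around $x$, $\mathcal{B}_r(\sigma)=\bigcup_{\tau\in[0,1]}\mathcal{B}_r(\sigma(\tau))$, and $\textup{Im}(\sigma)$ the image of $\sigma$. A path $\sigma\in\Sigma(S,T)$ is robust if for every $\varepsilon>0$ there is $\delta>0$ such that $\mathcal{M}(\sigma')\leq(1+\varepsilon)\mathcal{M}(\sigma)$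 for every $\sigma'\in\Sigma(S,T)$ with $\textup{Im}(\sigma')\subset\mathcal{B}_\delta(\sigma)$. Let $\vec\sigma^*$ be a robustly-optimal monotone path, i.e., a monotone robust path attaining the infimum bottleneck cost over all such paths. Assume there is a constant $\delta'>0$ with $\mathcal{B}_{\delta'}(\vec\sigma^* )\subset[0,1]^d$, and a constant $0<\delta''\leq 1$ with $S\preceq_{\delta''}T$. Let $\mathcal{X}_n$ be $n$ points drawn independently and uniformly at random from $[0,1]^d$. The random geometric graph $\mathcal{G}(\mathcal{X};r_n)$ is the directed graph on vertex set $\mathcal{X}$ with an edge $(x,y)$ for all distinct $x,y\in\mathcal{X}$ with $\|x-y\|_2\leq r_n$; each edge is viewed as the straight-line segment between its endpoints, so a path in the graph is a polygonal curve, and it is monotone if consecutive vertices satisfy $x\preceq y$. An event holds almost surely (a.s.) if its probability tends to $1$ as $n\rightarrow\infty$. Logarithms are natural.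
   Formalization: The equality M(σ_n)=(1+o(1))M(σ* ) is read as the upper bound M(σ_n)≤(1+o(1))M(σ* ); equality fails, e.g., for M=1 on a countable dense set off the line ST and 1/2 elsewhere, where M(σ* )=1 but graph paths a.s. cost 1/2. *)

(* Defs.v *)
From HB Require Import structures.
From mathcomp Require Import all_boot all_order all_algebra.
From mathcomp Require Import all_classical all_reals all_analysis.
Set Implicit Arguments. Unset Strict Implicit. Unset Printing Implicit Defensive.
Import Order.TTheory GRing.Theory Num.Theory.
Import numFieldNormedType.Exports.
Local Open Scope classical_set_scope.
Local Open Scope ring_scope.

Definition unit_cube (R : realType) (d : nat) : set 'rV[R]_d :=
  [set x | forall i, 0 <= x ord0 i <= 1].
Arguments unit_cube {R} d.

Definition edist (R : realType) (d : nat) (x y : 'rV[R]_d) : R :=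
  Num.sqrt (\sum_(i < d) (x ord0 i - y ord0 i) ^+ 2).

Definition eball (R : realType) (d : nat) (x : 'rV[R]_d) (r : R) : set 'rV[R]_d :=
  [set y | edist x y < r].

Definition preceq (R : realType) (d : nat) (x y : 'rV[R]_d) : Prop :=
  forall i, x ord0 i <= y ord0 i.

Definition preceq_delta (R : realType) (d : nat) (delta : R) (x y : 'rV[R]_d) : Prop :=
  preceq x y /\ (forall i, delta <= y ord0 i - x ord0 i) /\
  (exists i, y ord0 i - x ord0 i = delta).

(* Sigma(S,T): continuous paths [0,1] -> [0,1]^d from S to T
   (a path is a function R -> R^d, only its values on [0,1] matter) *)
Definition is_path (R : realType) (d : nat) (S T : 'rV[R]_d) (sigma : R -> 'rV[R]_d) : Prop :=
  {within `[0, 1], continuous sigma} /\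
  (forall t, t \in `[0, 1] -> unit_cube d (sigma t)) /\
  sigma 0 = S /\ sigma 1 = T.

Definition path_image (R : realType) (d : nat) (sigma : R -> 'rV[R]_d) : set 'rV[R]_d :=
  sigma @` `[0, 1].

Definition bcost_set (R : realType) (d : nat) (M : 'rV[R]_d -> R) (A : set 'rV[R]_d) : \bar R :=
  ereal_sup [set (M x)%:E | x in A].

(* M(sigma) = max_{tau in [0,1]} M(sigma tau)  (taken as a supremum) *)
Definition bcost (R : realType) (d : nat) (M : 'rV[R]_d -> R) (sigma : R -> 'rV[R]_d) : \bar R :=
  bcost_set M (path_image sigma).

Definition monotone_path (R : realType) (d : nat) (sigma : R -> 'rV[R]_d) : Prop :=
  forall t t', 0 <= t -> t <= t' -> t' <= 1 -> preceq (sigma t) (sigma t').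

Definition path_nbhd (R : realType) (d : nat) (sigma : R -> 'rV[R]_d) (r : R) : set 'rV[R]_d :=
  \bigcup_(t in `[0, 1]) eball (sigma t) r.

Definition robust (R : realType) (d : nat) (M : 'rV[R]_d -> R) (S T : 'rV[R]_d)
    (sigma : R -> 'rV[R]_d) : Prop :=
  is_path S T sigma /\
  forall eps : R, 0 < eps -> exists delta : R, 0 < delta /\
    forall sigma', is_path S T sigma' ->
      path_image sigma' `<=` path_nbhd sigma delta ->
      (bcost M sigma' <= (1 + eps)%:E * bcost M sigma)%E.

Definition robustly_optimal_monotone (R : realType) (d : nat) (M : 'rV[R]_d -> R)
    (S T : 'rV[R]_d) (sigma : R -> 'rV[R]_d) : Prop :=
  robust M S T sigma /\ monotone_path sigma /\
  forall sigma', robust M S T sigma' -> monotone_path sigma' ->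
    (bcost M sigma <= bcost M sigma')%E.

Definition segment (R : realType) (d : nat) (x y : 'rV[R]_d) : set 'rV[R]_d :=
  [set (1 - s) *: x + s *: y | s in `[0, 1]].

Fixpoint chain (T : Type) (e : T -> T -> Prop) (x : T) (s : seq T) : Prop :=
  match s with
  | [::] => True
  | y :: s' => e x y /\ chain e y s'
  end.

Fixpoint poly_image (R : realType) (d : nat) (x : 'rV[R]_d) (s : seq 'rV[R]_d)
    : set 'rV[R]_d :=
  match s with
  | [::] => [set x]
  | y :: s' => segment x y `|` poly_image y s'
  end.

Definition rgg_edge (R : realType) (d : nat) (V : set 'rV[R]_d) (r : R)
    (x y : 'rV[R]_d) : Prop :=
  V x /\ V y /\ x <> y /\ edist x y <= r.

Definition rgg_mon_edge (R : realType) (d : nat) (V : set 'rV[R]_d) (r : R)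
    (x y : 'rV[R]_d) : Prop :=
  rgg_edge V r x y /\ preceq x y.

Definition has_good_monotone_path (R : realType) (d : nat) (M : 'rV[R]_d -> R)
    (V : set 'rV[R]_d) (r : R) (S T : 'rV[R]_d) (c : \bar R) : Prop :=
  exists s : seq 'rV[R]_d,
    last S s = T /\ chain (rgg_mon_edge V r) S s /\
    (bcost_set M (poly_image S s) <= c)%E.

Definition sample_point (R : realType) (d : nat) (Omega : Type)
    (X : nat -> 'I_d -> Omega -> R) (i : nat) (w : Omega) : 'rV[R]_d :=
  \row_(k < d) X i k w.

Definition vertex_set (R : realType) (d : nat) (Omega : Type)
    (X : nat -> 'I_d -> Omega -> R) (n : nat) (S T : 'rV[R]_d) (w : Omega)
    : set 'rV[R]_d :=
  [set x | x = S \/ x = T \/ exists2 i, (i < n)%N & x = sample_point X i w].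

(* The coordinates X i k (i : nat, k < d) are mutually independent random
   variables, each uniformly distributed on [0,1].  Hence the points
   sample_point X 0, ..., sample_point X (n-1) are n independent uniform
   points of [0,1]^d. *)
Definition iid_uniform_coords (R : realType) (d : nat) (dO : measure_display)
    (Omega : measurableType dO) (P : probability Omega R)
    (X : nat -> 'I_d -> Omega -> R) : Prop :=
  (forall i k, measurable_fun setT (X i k)) /\
  (forall i k (B : set R), measurable B ->
     P (X i k @^-1` B) = lebesgue_measure (B `&` `[0, 1])) /\
  (forall (J : seq (nat * 'I_d)) (B : nat * 'I_d -> set R),
     uniq J -> (forall j, measurable (B j)) ->
     P (\bigcap_(j in [set` J]) (X j.1 j.2 @^-1` B j)) =
     (\prod_(j <- J) P (X j.1 j.2 @^-1` B j))%E).

(* Main.v *)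
(* Fix a margin [delta] from robustness.  Pull the optimal path slightly towards
   the segment from S to T, and mark points q_0 = S, ..., q_K = T on the result so
   that between consecutive marks every coordinate grows by at least a = c / K
   and at most d / K.  If each cube q_j + [0, a)^d contains a sample point, then
   joining these points in order gives a monotone polygonal curve with short
   edges inside the [delta]-neighbourhood, to which robustness applies.  For K of
   order (n / log n)^(1/d), a union bound shows that with probability tending to 1
   no cube is empty.  A diagonal argument lets the tolerance go to 0 with n. *)
Require Import Defs.
From HB Require Import structures.
From mathcomp Require Import all_boot all_order all_algebra.
From mathcomp Require Import all_classical all_reals all_analysis.
From mathcomp Require Import ring lra.
Import Order.TTheory GRing.Theory Num.Theory.
Import numFieldNormedType.Exports.
Local Open Scope classical_set_scope.
Local Open Scope ring_scope.

(** * Polygonal curves as continuous paths *)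

Lemma segmentP {R : realType} {d} (x y : 'rV[R]_d) :
  segment x y = (fun s : R => x + s *: (y - x)) @` `[0, 1].
Proof.
rewrite /segment; apply: eq_imagel => s _.
by rewrite scalerBl scalerBr scale1r addrAC addrA.
Qed.

Definition clamp {R : realType} (t : R) : R := Num.max 0 (Num.min 1 t).

Lemma continuous_clamp {R : realType} : continuous (@clamp R).
Proof.
move=> t; apply: (@continuous_max R R (cst 0) (fun t => Num.min 1 t)).
  exact: cvg_cst.
apply: (@continuous_min R R (cst 1) id); first exact: cvg_cst.
exact: cvg_id.
Qed.

(** Robustness speaks of paths while the graph provides polygons; this is the bridge. Continuity on
    the whole line and the constant value left of 0 are what lets the induction glue pieces. *)
Lemma polyline {R : realType} {d} (x : 'rV[R]_d) (s : seq 'rV[R]_d) :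
  exists gamma : R -> 'rV[R]_d, [/\ continuous gamma,
    forall t, t <= 0 -> gamma t = x, gamma 1 = last x s &
    gamma @` `[0, 1] = poly_image x s].
Proof.
elim: s x => [|y s IH] x /=.
  exists (cst x); split => //; first by move=> t; exact: cvg_cst.
  apply/seteqP; split => [z [t _ <-//]|z ->]; exists 0 => //.
  by rewrite /= in_itv /= lexx ler01.
have [g [gc g0 g1 gim]] := IH y.
have c0 (t : R) : t <= 0 -> clamp t = 0.
  by rewrite /clamp => t0; apply/max_idPl; rewrite ge_min t0 orbT.
have c1 (t : R) : 1 <= t -> clamp t = 1.
  by move=> t1; rewrite /clamp (min_idPl t1); apply/max_idPr.
have c01 (t : R) : 0 <= t <= 1 -> clamp t = t.
  by move=> /andP[t0 t1]; rewrite /clamp (min_idPr t1); apply/max_idPr.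
(* No case split at 1/2 is needed for continuity: before it the [g] bracket vanishes, as [g] equals
   [y] at nonpositive arguments; after it the clamped term stays at [y]. *)
pose h t := (x + clamp (2 * t) *: (y - x)) + (g (2 * t - 1) - y).
have hl t : 0 <= t <= 2^-1 -> h t = x + (2 * t) *: (y - x).
  by move=> t01; rewrite /h c01 ?g0 ?subrr ?addr0//; lra.
have hr t : 2^-1 <= t -> h t = g (2 * t - 1).
  move=> t2; rewrite /h c1; last lra.
  by rewrite scale1r addrC [x + _]addrC !subrK.
exists h; split.
- move=> t.
  have c2 : (2 * u)%R @[u --> t] --> (2 * t : R) by exact: mulrl_continuous.
  have c3 : (2 * u - 1)%R @[u --> t] --> (2 * t - 1 : R).
    by apply: cvgB; [exact: c2|exact: cvg_cst].
  apply: cvgD; last by apply: cvgB; [exact: cvg_comp c3 (gc _)|exact: cvg_cst].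
  apply: cvgD; first exact: cvg_cst.
  apply: cvgZ; last exact: cvg_cst.
  exact: cvg_comp c2 (continuous_clamp _).
- move=> t t0; rewrite /h c0 ?g0 ?scale0r ?subrr ?addr0//; lra.
- by rewrite hr; [rewrite -g1; congr g|]; lra.
- rewrite -gim segmentP; apply/seteqP; split => z.
    move=> [t]; rewrite /= in_itv /= => /andP[t0 t1] <-.
    have [t2|t2] := leP t 2^-1.
      left; exists (2 * t); rewrite ?hl ?t0 //= in_itv /=; lra.
    right; exists (2 * t - 1); rewrite ?hr ?(ltW t2) //= in_itv /=; lra.
  case=> [[t]|[t]]; rewrite /= in_itv /= => /andP[t0 t1] <-.
    exists (t / 2); first by rewrite /= in_itv /=; lra.
    rewrite hl; last lra.
    by congr (_ + _ *: _); lra.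
  exists ((t + 1) / 2); first by rewrite /= in_itv /=; lra.
  by rewrite hr; [congr g|]; lra.
Qed.

(** * Diagonal sequences and the choice of scale *)

(** Take for [f n] the largest [m <= n] with [Q m n]; the cap at [n] makes the maximum exist. Each
    fixed [m] is eventually a candidate, so [f] diverges, and [m = 0] ensures that candidates
    eventually exist. *)
Lemma diagonal_cvg (Q : nat -> nat -> Prop) :
  (forall m, \forall n \near \oo, Q m n) ->
  exists f : nat -> nat, f @ \oo --> \oo /\ \forall n \near \oo, Q (f n) n.
Proof.
move=> hQ.
pose p n m := (m <= n)%N && `[< Q m n >].
have choice n : exists m, (forall k, p n k -> (k <= m)%N) /\ ((exists k, p n k) -> p n m).
  have [ex|nex] := pselect (exists k, p n k); last first.
    by exists 0%N; split=> // k pk; exfalso; apply: nex; exists k.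
  have bd k : p n k -> (k <= n)%N by case/andP.
  by case: (ex_maxnP ex bd) => m pm hm; exists m; split.
have [f hf] := @boolp.choice _ _ (fun n m => (forall k, p n k -> (k <= m)%N) /\ ((exists k, p n k) -> p n m)) choice.
exists f; split.
  apply/cvgnyPge => m.
  have Qm := hQ m; near=> n.
  have [+ _] := hf n; apply; rewrite /p; apply/andP; split; last first.
    by apply/asboolP; near: n; exact: Qm.
  by near: n; exact: nbhs_infty_ge.
have Q0 := hQ 0%N; near=> n.
have [_ h] := hf n.
have /andP[_ /asboolP//] : p n (f n).
by apply: h; exists 0%N; rewrite /p leq0n; apply/asboolP; near: n; exact: Q0.
Unshelve. all: by end_near. Qed.

(** With [u] the square root of [n], [ln n = 2 ln u < 2 u], so the quotient is below [2 / u]. *)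
Lemma ln_div_cvg0 {R : realType} : (ln (n%:R : R) / n%:R) @[n --> \oo] --> (0 : R).
Proof.
apply/cvgrPdist_lt => e e0.
have [N hN] : exists N : nat, (2 / e) ^+ 2 < N%:R :> R.
  by exists (Num.trunc ((2 / e) ^+ 2)).+1; exact: truncnS_gt.
exists N.+1 => // n /= Nn.
have n0 : 0 < n%:R :> R by rewrite ltr0n (leq_trans _ Nn).
have n1 : 1 <= n%:R :> R by rewrite ler1n (leq_trans _ Nn).
rewrite sub0r normrN ger0_norm; last by rewrite divr_ge0 ?ln_ge0// ltW.
rewrite ltr_pdivrMr//.
set u := Num.sqrt (n%:R : R).
have u0 : 0 < u by rewrite sqrtr_gt0.
have uu : u * u = n%:R by rewrite -expr2 sqr_sqrtr// ltW.
have lu : ln u < u by exact: ln_sublinear.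
rewrite -uu lnM//.
have : 2 / e < u.
  rewrite -(@ltr_pXn2r _ 2)// ?nnegrE ?divr_ge0 ?ltW//.
  by rewrite [u ^+ 2]expr2 uu (lt_le_trans hN)// ler_nat ltnW.
rewrite ltr_pdivrMr// => h.
have : 2 * u < u * e * u by rewrite ltr_pM2r.
lra.
Qed.

(* With [rho = (ln n / n)^(1/d)] and [K = floor (c / (2 rho))] one has
   [n (c/K)^d >= 2^d ln n >= 2 ln n], so that [K (1 - (c/K)^d)^n <= K / n^2],
   while [K <= 1 / rho <= n]. *)
Lemma scale_choice {R : realType} {d : nat} {r : nat -> R} {c D h eta : R} :
  (0 < d)%N ->
  (r n / powR (ln n%:R / n%:R) d%:R^-1) @[n --> \oo] --> +oo ->
  0 < c <= 1 -> 0 < D -> 0 < h -> 0 < eta ->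
  \forall n \near \oo, exists2 K : nat, (0 < K)%N &
    [/\ D / K%:R <= r n, D / K%:R <= h &
        K%:R * (1 - (c / K%:R) ^+ d) ^+ n <= eta].
Proof.
move=> d0 hr /andP[c0 c1] D0 h0 eta0.
pose rho n : R := powR (ln n%:R / n%:R) d%:R^-1.
have dR : 0 < d%:R :> R by rewrite ltr0n.
have rhoX n : (0 < n)%N -> rho n ^+ d = ln n%:R / n%:R.
  move=> n0; have x0 : 0 <= ln n%:R / n%:R :> R by rewrite divr_ge0 ?ln_ge0 ?ler1n.
  by rewrite /rho -powR_mulrn ?powR_ge0// -powRrM mulVf ?gt_eqF// powRr1.
have rho_small (e : R) : 0 < e -> \forall n \near \oo, rho n <= e.
  move=> e0.
  have := @ln_div_cvg0 R; move/cvgrPdist_lt => /(_ (e ^+ d) (exprn_gt0 _ e0)).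
  move=> H; near=> n.
  have n0 : (0 < n)%N by near: n; exact: nbhs_infty_gt.
  rewrite -(@ler_pXn2r _ d)// ?nnegrE ?powR_ge0// ?ltW// rhoX//.
  have : `|0 - ln n%:R / n%:R| < e ^+ d by near: n; exact: H.
  by rewrite sub0r normrN; exact: le_lt_trans (ler_norm _).
have expR1 : \forall n \near \oo, expR 1 <= n%:R :> R.
  exact: nbhs_infty_ger.
have etaN : \forall n \near \oo, eta^-1 <= n%:R :> R by exact: nbhs_infty_ger.
have hr' : \forall n \near \oo, 4 * D / c <= r n / rho n.
  by move/cvgryPge : hr; exact.
near=> n.
have n0 : (0 < n)%N by near: n; exact: nbhs_infty_gt.
have nR : 0 < n%:R :> R by rewrite ltr0n.
have ln1 : 1 <= ln n%:R :> R.
  by rewrite -[leLHS](expRK 1) ler_ln ?posrE ?expR_gt0//; near: n; exact: expR1.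
have rho0 : 0 < rho n.
  by rewrite powR_gt0// divr_gt0// (lt_le_trans _ ln1).
(* Because [ln n >= 1], [n^(-d) <= 1/n <= ln n / n = rho^d]. *)
have rhoV : (rho n)^-1 <= n%:R.
  rewrite invf_ple ?posrE// -(@ler_pXn2r _ d)// ?nnegrE ?invr_ge0 ?ler0n ?powR_ge0//.
  rewrite rhoX//; apply: (@le_trans _ _ (n%:R^-1)).
    by apply: ler_iXnr; rewrite ?invr_ge0 ?ler0n// invf_le1// ler1n.
  by rewrite -[leLHS]mul1r ler_pM2r ?invr_gt0.
pose x := c / (2 * rho n).
have x0 : 0 < x by rewrite divr_gt0// mulr_gt0.
have x2 : 2 <= x.
  rewrite /x ler_pdivlMr ?mulr_gt0//.
  have : rho n <= c / 4 by near: n; apply: rho_small; rewrite divr_gt0.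
  lra.
have Kx : (Num.trunc x)%:R <= x by rewrite truncn_le ltW.
have xK : x < (Num.trunc x).+1%:R by exact: truncnS_gt.
(* From [x >= 2], [x / 2 <= x - 1], so truncation at most halves [x]. *)
have K2 : x / 2 <= (Num.trunc x)%:R.
  by move: xK; rewrite -natr1; lra.
set K := Num.trunc x in Kx xK K2 *.
have KR : 0 < K%:R :> R by lra.
have K0 : (0 < K)%N by rewrite -(ltr0n R).
(* [K >= x / 2 = c / (4 rho)]. The resulting bound is below [r n] because [r n / rho n] diverges,
   and below [h] because [rho] tends to 0. *)
have DK : D / K%:R <= 4 * D / c * rho n.
  apply: (@le_trans _ _ (D / (x / 2))).
    by rewrite ler_pM2l// lef_pV2 ?posrE ?divr_gt0 ?mulr_gt0.
  rewrite /x le_eqVlt; apply/orP; left; apply/eqP; field.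
  by rewrite !gt_eqF.
exists K => //; split.
- apply: (le_trans DK); rewrite -ler_pdivlMr//; near: n; exact: hr'.
- apply: (le_trans DK).
  have : rho n <= h / (4 * D / c) by near: n; apply: rho_small; rewrite !(divr_gt0, mulr_gt0).
  by rewrite ler_pdivlMr ?divr_gt0 ?mulr_gt0// mulrC.
set u := (c / K%:R) ^+ d.
have u1 : u <= 1.
  apply: exprn_ile1; first by rewrite divr_ge0// ltW.
  by rewrite ler_pdivrMr// mul1r (le_trans c1)// ler1n.
have lnu : 2 * ln n%:R <= n%:R * u.
  have -> : 2 * ln n%:R = n%:R * (2 * (ln n%:R / n%:R)) :> R.
    by field; rewrite gt_eqF.
  rewrite ler_pM2l// -rhoX//.
  have cK : 2 * rho n <= c / K%:R.
    by move: Kx; rewrite /x ler_pdivlMr// ?mulr_gt0// [K%:R * _]mulrC ler_pdivlMr.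
  apply: (@le_trans _ _ ((2 * rho n) ^+ d)); last first.
    by apply: lerXn2r; rewrite ?nnegrE ?mulr_ge0 ?divr_ge0 ?ler0n ?powR_ge0// ltW.
  rewrite exprMn ler_pM2r ?exprn_gt0//.
  by apply: ler_eXnr; rewrite // ler1n.
have uX : (1 - u) ^+ n <= (n%:R * n%:R)^-1.
  apply: (@le_trans _ _ (expR (- u) ^+ n)).
    apply: lerXn2r; rewrite ?nnegrE ?subr_ge0 ?expR_ge0//.
    exact: expR_ge1Dx.
  rewrite -expRM_natl mulrN -[leRHS]lnK ?posrE ?invr_gt0 ?mulr_gt0// ler_expR.
  rewrite lnV ?posrE ?mulr_gt0// lnM// lerN2; lra.
apply: (@le_trans _ _ (n%:R * (n%:R * n%:R)^-1)).
  apply: ler_pM => //; first by rewrite exprn_ge0 ?subr_ge0.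
  apply: le_trans rhoV; apply: (le_trans Kx).
  rewrite /x invfM mulrA -[leRHS]mul1r ler_pM2r ?invr_gt0//; lra.
rewrite invfM mulrA divff ?gt_eqF// mul1r invf_ple ?posrE//.
by near: n; exact: etaN.
Unshelve. all: by end_near. Qed.

(** * Probability that every cube contains a sample point *)

Lemma probability_no_success {R : realType} {dO : measure_display}
    {Omega : measurableType dO} (P : probability Omega R)
    (E : nat -> set Omega) (p : R) :
  (forall i, measurable (E i)) ->
  (forall s : seq nat, uniq s -> P (\bigcap_(i in [set` s]) E i) = (p ^+ size s)%:E) ->
  forall n, P (\bigcap_(i in `I_n) ~` E i) = ((1 - p) ^+ n)%:E.
Proof.
move=> mE hE n.
suff H : forall n s, uniq s -> (forall i, i \in s -> (n <= i)%N) ->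
    P ((\bigcap_(i in `I_n) ~` E i) `&` \bigcap_(i in [set` s]) E i)
    = ((1 - p) ^+ n * p ^+ size s)%:E.
  by have := H n [::] isT; rewrite set_nil bigcap_set0 setIT expr0 mulr1; apply.
have mB (s : seq nat) : measurable (\bigcap_(i in [set` s]) E i).
  by apply: bigcap_measurableType => i _; exact: mE.
have mC k : measurable (\bigcap_(i in `I_k) ~` E i).
  by apply: bigcap_measurableType => i _; apply: measurableC; exact: mE.
move=> {}n; elim: n => [|n IH] s us hs.
  by rewrite II0 bigcap_set0 setTI hE// expr0 mul1r.
have -> : (\bigcap_(i in `I_n.+1) ~` E i) `&` \bigcap_(i in [set` s]) E i =
  ((\bigcap_(i in `I_n) ~` E i) `&` \bigcap_(i in [set` s]) E i) `\` E n.
  rewrite IIS bigcap_setU bigcap_set1 setDE.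
  by rewrite -!setIA [~` E n `&` _]setIC.
rewrite measureD//; last 2 first.
- exact: measurableI.
- by rewrite (le_lt_trans (probability_le1 _ _)) ?ltry//; exact: measurableI.
have hs' i : i \in s -> (n <= i)%N by move=> /hs /ltnW.
rewrite -setIA [_ `&` E n]setIC -(bigcap_set1 E n) -bigcap_setU.
have -> : [set n] `|` [set` s] = [set` n :: s].
  apply/seteqP; split=> i /=; rewrite inE; first by move=> [->|->]; rewrite ?eqxx ?orbT.
  by move=> /orP[/eqP ->|]; [left|right].
have un : uniq (n :: s).
  by rewrite /= us andbT; apply/negP => /hs; rewrite ltnn.
have hn i : i \in n :: s -> (n <= i)%N.
  by rewrite inE => /orP[/eqP ->//|/hs'].
apply: (etrans (congr2 (fun a b => a - b)%E (IH s us hs') (IH _ un hn))).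
by rewrite -EFinB /= !exprS; congr EFin; ring.
Qed.

(** Half-open, so that points of cubes whose corners differ by at least [a] in every coordinate are
    strictly ordered, hence distinct. *)
Definition corner_cube {R : realType} {d : nat} (q : 'rV[R]_d) (a : R) : set 'rV[R]_d :=
  [set x | forall k, q ord0 k <= x ord0 k < q ord0 k + a].

Section cube_samples.
Context {R : realType} {d : nat} {dO : measure_display}
  {Omega : measurableType dO} (P : probability Omega R)
  {X : nat -> 'I_d -> Omega -> R} (hX : iid_uniform_coords P X).

Lemma sample_cube_preimage (q : 'rV[R]_d) (a : R) (i : nat) :
  [set w | corner_cube q a (sample_point X i w)] =
  \bigcap_(k in [set: 'I_d]) (X i k @^-1` `[q ord0 k, q ord0 k + a[).
Proof.
apply/seteqP; split => w h k; first by move=> _; have := h k; rewrite mxE /= in_itv.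
by have := h k Logic.I; rewrite mxE /= in_itv.
Qed.

Lemma measurable_sample_cube (q : 'rV[R]_d) (a : R) (i : nat) :
  measurable [set w | corner_cube q a (sample_point X i w)].
Proof.
rewrite sample_cube_preimage; apply: fin_bigcap_measurable => // k _.
by rewrite -[_ @^-1` _]setTI; apply: (hX.1 i k) => //; exact: measurable_itv.
Qed.

Lemma probability_samples_cube (q : 'rV[R]_d) (a : R) (s : seq nat) : 0 <= a ->
  (forall k, 0 <= q ord0 k /\ q ord0 k + a <= 1) -> uniq s ->
  P (\bigcap_(i in [set` s]) [set w | corner_cube q a (sample_point X i w)]) =
  ((a ^+ d) ^+ size s)%:E.
Proof.
move=> a0 q01 us; have [mX [hP hI]] := hX.
pose B (j : nat * 'I_d) : set R := `[q ord0 j.2, q ord0 j.2 + a[%classic.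
(* Independence is stated per coordinate: the event splits into [d * size s] coordinate events, each
   of probability [a] since the cube lies in the unit cube. *)
pose J := [seq (i, k) | i <- s, k <- enum 'I_d].
have uJ : uniq J.
  by apply: allpairs_uniq => //; [exact: enum_uniq|move=> [? ?] [? ?]].
have -> : \bigcap_(i in [set` s]) [set w | corner_cube q a (sample_point X i w)] =
    \bigcap_(j in [set` J]) (X j.1 j.2 @^-1` B j).
  apply/seteqP; split => w h.
    move=> _ /= /allpairsP[[i k] /= [si _ ->]] /=.
    by have := h i si; rewrite sample_cube_preimage => /(_ k Logic.I).
  move=> i si; rewrite sample_cube_preimage => k _.
  apply: (h (i, k)) => /=.
  by apply/allpairsP; exists (i, k); rewrite /= mem_enum.
rewrite hI//; last by move=> j; exact: measurable_itv.
have pB j : P (X j.1 j.2 @^-1` B j) = a%:E.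
  rewrite hP; last exact: measurable_itv.
  have [q0 q1] := q01 j.2.
  rewrite setIidl; last by move=> x /=; rewrite !in_itv /= => /andP[qx xq];
    rewrite (le_trans q0 qx) (le_trans (ltW xq) q1).
  rewrite lebesgue_measure_itv /= lte_fin.
  case: ltP => [_|h]; first by rewrite -EFinB; congr EFin; ring.
  by congr EFin; lra.
under eq_bigr do rewrite pB.
rewrite prodEFin; congr EFin.
rewrite big_const_seq count_predT iter_mulr_1 size_allpairs size_enum_ord.
by rewrite mulnC exprM.
Qed.

Lemma hit_all_cubes (K n : nat) (q : nat -> 'rV[R]_d) (a : R) : 0 <= a ->
  (forall j k, (j < K)%N -> 0 <= q j ord0 k /\ q j ord0 k + a <= 1) ->
  let A := \bigcap_(j in `I_K) \bigcup_(i in `I_n)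
    [set w | corner_cube (q j) a (sample_point X i w)] in
  measurable A /\ ((1 - K%:R * (1 - a ^+ d) ^+ n)%:E <= P A)%E.
Proof.
move=> a0 q01 A.
pose U j := \bigcup_(i in `I_n) [set w | corner_cube (q j) a (sample_point X i w)].
have mU j : measurable (U j).
  by apply: bigcup_measurable => i _; exact: measurable_sample_cube.
have mA : measurable A by apply: bigcap_measurableType => j _; exact: mU.
split=> //.
(* Union bound over the [K] cubes, each missed by all [n] samples with probability [(1 - a^d)^n]. *)
have : (P (~` A) <= (K%:R * (1 - a ^+ d) ^+ n)%:E)%E.
  rewrite setC_bigcap bigcup_mkord.
  apply: (le_trans (@Boole_inequality _ _ _ P (fun j => ~` U j) K _)).
    by move=> j _; apply: measurableC; exact: mU.
  rewrite (eq_bigr (fun=> ((1 - a ^+ d) ^+ n)%:E)); last first.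
    move=> j _; rewrite setC_bigcup; apply: probability_no_success.
      by move=> i; exact: measurable_sample_cube.
    move=> s us; apply: probability_samples_cube => // k.
    exact: q01.
  by rewrite sumEFin sumr_const card_ord lee_fin mulr_natl.
rewrite probability_setC// -(fineK (fin_num_measure P _ mA)) -EFinB !lee_fin.
lra.
Qed.

End cube_samples.

(** * Waypoints along the optimal path *)

Lemma continuous_within_coord {R : realType} {d : nat} (A : set R)
    (sigma : R -> 'rV[R]_d) (i : 'I_d) :
  {within A, continuous sigma} -> {within A, continuous (fun t => sigma t ord0 i)}.
Proof.
move=> c t.
exact: (continuous_comp (c t) (@coord_continuous _ _ _ ord0 i (sigma t))).
Qed.

(** The sharp factor is the square root of [d]; the cruder [d] suffices for every later estimate. *)
Lemma edist_le {R : realType} {d : nat} (x y : 'rV[R]_d) (e : R) : 0 <= e ->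
  (forall i, `|x ord0 i - y ord0 i| <= e) -> Defs.edist x y <= d%:R * e.
Proof.
move=> e0 h; rewrite /Defs.edist -[leRHS]ger0_norm ?mulr_ge0 ?ler0n// -sqrtr_sqr.
apply: ler_wsqrtr; apply: (@le_trans _ _ (\sum_(i < d) e ^+ 2)).
  apply: ler_sum => i _; rewrite -[leLHS]ger0_norm ?sqr_ge0// normrX.
  by apply: lerXn2r; rewrite ?nnegrE.
rewrite sumr_const card_ord -[leLHS]mulr_natl exprMn ler_wpM2r ?sqr_ge0//.
by case: (d) => [|k]; rewrite ?expr0n// ler_eXnr// ler1n.
Qed.

(* The points of [sigma] where [g = sum_i (sigma_i - S_i) / sum_i (T_i - S_i)]
   equals [j / K], pulled towards the diagonal point of parameter [j / K]: the
   monotonicity of [sigma] bounds each coordinate increment by the increment of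
   [g], and the diagonal bounds it from below. *)
Lemma waypoints {R : realType} {d : nat} (S T : 'rV[R]_d) (sigma : R -> 'rV[R]_d)
    (delta beta : R) (K : nat) :
  (0 < d)%N -> is_path S T sigma -> monotone_path sigma -> unit_cube d S -> unit_cube d T ->
  0 < delta -> (forall i, delta <= T ord0 i - S ord0 i) ->
  0 <= beta <= 1 -> (0 < K)%N ->
  exists q : nat -> 'rV[R]_d, [/\ q 0 = S, q K = T,
    forall j i, (j < K)%N ->
      beta * delta / K%:R <= q j.+1 ord0 i - q j ord0 i <= d%:R / K%:R,
    forall j i, (j <= K)%N -> 0 <= q j ord0 i <= 1 &
    forall j, (j <= K)%N -> exists2 t, t \in `[0, 1] &
      forall i, `|q j ord0 i - sigma t ord0 i| <= beta].
Proof.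
move=> d0 [cs [scube [s0 s1]]] mono S01 T01 delta0 ST /andP[b0 b1] K0.
have KR : 0 < K%:R :> R by rewrite ltr0n.
have ge1 : 1 <= d%:R :> R by rewrite ler1n.
pose D : R := \sum_(i < d) (T ord0 i - S ord0 i).
pose f t : R := \sum_(i < d) (sigma t ord0 i - S ord0 i).
have D0 : 0 < D.
  apply: (@lt_le_trans _ _ (\sum_(i < d) delta)).
    by rewrite sumr_const card_ord pmulrn_lgt0.
  by apply: ler_sum => i _.
have Dd : D <= d%:R.
  rewrite -[leRHS]mulr1 mulr_natl -[in leRHS](card_ord d) -sumr_const.
  by apply: ler_sum => i _; have := S01 i; have := T01 i; lra.
have cf : {within `[0, 1], continuous f}.
  move=> t; apply: cvg_big => [|i _]; first exact: add_continuous.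
  apply: cvgB; last exact: cvg_cst.
  exact: continuous_within_coord.
have f0 : f 0 = 0 by rewrite /f s0 big1// => i _; rewrite subrr.
have f1 : f 1 = D by rewrite /f s1.
(* The intermediate value theorem gives the inner times. The end times are fixed to 0 and 1 so that
   the marks start at [S] and end at [T]; indices beyond [K] get the dummy value 0. *)
have tau_ex j : exists t, (j <= K)%N ->
    [/\ t \in `[0, 1], f t = D * (j%:R / K%:R), j = 0%N -> t = 0 & j = K -> t = 1].
  have [jK|] := leqP j K; last by exists 0.
  case: (posnP j) => [->|j0].
    exists 0 => _; rewrite in_itv /= lexx ler01 f0 mul0r mulr0; split => //.
    by move=> K00; move: K0; rewrite -K00.
  have [->|jK'] := eqVneq j K.
    exists 1 => _; rewrite in_itv /= lexx ler01 f1 divff ?gt_eqF// mulr1; split => //.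
    by move=> K00; move: K0; rewrite K00.
  have [|t t01 ft] := @IVT R f 0 1 (D * (j%:R / K%:R)) ler01 cf.
    have jK1 : 0 <= (j%:R / K%:R : R) <= 1.
      by rewrite divr_ge0// ler_pdivrMr// mul1r ler_nat.
    move: jK1 => /andP[u0 u1]; rewrite f0 f1 (min_idPl (ltW D0)) (max_idPr (ltW D0)).
    by rewrite mulr_ge0 ?(ltW D0)//= -[leRHS]mulr1 ler_pM2l.
  exists t => _; split => //; first by move=> j00; move: j0; rewrite j00.
  by move=> jK''; move: jK'; rewrite jK'' eqxx.
have [tau htau] := boolp.choice tau_ex.
pose q j : 'rV[R]_d := \row_i ((1 - beta) * sigma (tau j) ord0 i +
  beta * (S ord0 i + (T ord0 i - S ord0 i) * (j%:R / K%:R))).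
have sub01 j i : (j <= K)%N -> 0 <= sigma (tau j) ord0 i <= 1.
  by move=> /htau[t01 _ _ _]; exact: scube.
have lin01 j i : (j <= K)%N ->
    0 <= S ord0 i + (T ord0 i - S ord0 i) * (j%:R / K%:R) <= 1.
  move=> jK; have : 0 <= (j%:R / K%:R : R) <= 1.
    by rewrite divr_ge0// ler_pdivrMr// mul1r ler_nat.
  have := S01 i; have := T01 i.
  set u := _ / _; move=> h1 h2 h3; nra.
exists q; split.
- have [_ _ /(_ erefl) tau0 _] := htau 0%N isT.
  by apply/rowP => i; rewrite mxE tau0 s0 mul0r mulr0; ring.
- have [_ _ _ /(_ erefl) tau1] := htau K (leqnn K).
  by apply/rowP => i; rewrite mxE tau1 s1 divff ?gt_eqF//; ring.
- move=> j i jK; rewrite !mxE.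
  have [t01 ft _ _] := htau j (ltnW jK); have [t01' ft' _ _] := htau j.+1 jK.
  have fD : f (tau j.+1) - f (tau j) = D / K%:R.
    by rewrite ft ft' -natr1; field; rewrite gt_eqF.
  (* Otherwise monotonicity of [sigma] would make [f] not increase from [tau j] to [tau j.+1],
     against [D / K > 0]. *)
  have tt : tau j <= tau j.+1.
    rewrite leNgt; apply/negP => lt.
    have : f (tau j.+1) <= f (tau j).
      apply: ler_sum => k _; rewrite lerD2r; apply: mono => //; last by move: t01; rewrite in_itv /= => /andP[].
        by move: t01'; rewrite in_itv /= => /andP[].
      exact: ltW.
    have : 0 < D / K%:R by rewrite divr_gt0.
    lra.
  have up k : sigma (tau j) ord0 k <= sigma (tau j.+1) ord0 k.
    apply: mono => //; first by move: t01; rewrite in_itv /= => /andP[].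
    by move: t01'; rewrite in_itv /= => /andP[].
  (* The increment of [f] is a sum of nonnegative coordinate increments, so it dominates each
     one. *)
  have upi : sigma (tau j.+1) ord0 i - sigma (tau j) ord0 i <= d%:R / K%:R.
    apply: (@le_trans _ _ (D / K%:R)); last by rewrite ler_pM2r ?invr_gt0.
    rewrite -fD /f -sumrB (eq_bigr (fun k => sigma (tau j.+1) ord0 k - sigma (tau j) ord0 k)).
      by rewrite (bigD1 i)//= lerDl; apply: sumr_ge0 => k _; rewrite subr_ge0.
    by move=> k _; ring.
  have upi0 := up i.
  have -> : (1 - beta) * sigma (tau j.+1) ord0 i +
      beta * (S ord0 i + (T ord0 i - S ord0 i) * (j.+1%:R / K%:R)) -
      ((1 - beta) * sigma (tau j) ord0 i +
      beta * (S ord0 i + (T ord0 i - S ord0 i) * (j%:R / K%:R))) =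
      (1 - beta) * (sigma (tau j.+1) ord0 i - sigma (tau j) ord0 i) +
      beta * ((T ord0 i - S ord0 i) / K%:R).
    by rewrite -natr1; field; rewrite gt_eqF.
  have lo : delta / K%:R <= (T ord0 i - S ord0 i) / K%:R by rewrite ler_pM2r ?invr_gt0.
  have hi : (T ord0 i - S ord0 i) / K%:R <= d%:R / K%:R.
    by rewrite ler_pM2r ?invr_gt0//; have := S01 i; have := T01 i; lra.
  rewrite -mulrA; set u := _ - sigma _ _ _ in upi *; set v := (T ord0 i - _) / _ in lo hi *.
  have u0 : 0 <= u by rewrite subr_ge0.
  apply/andP; split.
    by rewrite -[leLHS]add0r lerD ?mulr_ge0 ?ler_wpM2l// subr_ge0.
  have -> : d%:R / K%:R = (1 - beta) * (d%:R / K%:R) + beta * (d%:R / K%:R) :> R by ring.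
  by rewrite lerD// ler_wpM2l// subr_ge0.
- by move=> j i jK; rewrite mxE; have := sub01 j i jK; have := lin01 j i jK; nra.
- move=> j jK; have [t01 _ _ _] := htau j jK; exists (tau j) => // i; rewrite mxE.
  have := sub01 j i jK; have := lin01 j i jK.
  set u := S _ _ + _; set v := sigma _ _ _ => hu hv.
  (* The pull moves a point by [beta] times the gap between two numbers of the unit interval. *)
  rewrite (_ : _ - v = beta * (u - v)); last ring.
  rewrite normrM (ger0_norm b0) -[leRHS]mulr1 ler_wpM2l// ler_norml; lra.
Qed.

(** * From occupied cubes to a monotone polygonal curve *)

Lemma chain_map_iota {T : Type} (e : T -> T -> Prop) (y : nat -> T) (m n : nat) :
  (forall j, (m <= j < m + n)%N -> e (y j) (y j.+1)) ->
  chain e (y m) (map y (iota m.+1 n)).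
Proof.
elim: n m => [//|n IH] m h /=; split.
  by apply: h; rewrite leqnn addnS ltnS leq_addr.
by apply: IH => j /andP[mj jn]; apply: h; rewrite (ltnW mj) addnS -addSn.
Qed.

Lemma last_map_iota {T : Type} (y : nat -> T) (m n : nat) :
  last (y m) (map y (iota m.+1 n)) = y (m + n)%N.
Proof. by elim: n m => [|n IH] m /=; rewrite ?addn0// IH addSnnS. Qed.

Lemma poly_image_map_iota {R : realType} {d : nat} (A : set 'rV[R]_d)
    (y : nat -> 'rV[R]_d) (m n : nat) :
  A (y m) -> (forall j, (m <= j < m + n)%N -> segment (y j) (y j.+1) `<=` A) ->
  poly_image (y m) (map y (iota m.+1 n)) `<=` A.
Proof.
elim: n m => [|n IH] m Am h /=; first by move=> z ->.
have hm : segment (y m) (y m.+1) `<=` A.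
  by apply: h; rewrite leqnn addnS ltnS leq_addr.
move=> z [/hm//|]; apply: IH.
  by apply: hm; exists 1; rewrite ?/= ?in_itv /= ?ler01 ?lexx// subrr scale0r add0r scale1r.
by move=> j /andP[mj jn]; apply: h; rewrite (ltnW mj) addnS -addSn.
Qed.

Lemma good_monotone_path_of_cubes {R : realType} {d : nat} (M : 'rV[R]_d -> R)
    (S T : 'rV[R]_d) (sigma : R -> 'rV[R]_d) (V : set 'rV[R]_d) (r delta beta a h : R)
    (c : \bar R) (K : nat) (q : nat -> 'rV[R]_d) :
  (0 < d)%N -> (0 < K)%N -> 0 < a -> V S -> V T -> q 0 = S -> q K = T ->
  (forall j i, (j < K)%N -> a <= q j.+1 ord0 i - q j ord0 i <= h) ->
  (forall j, (j <= K)%N -> exists2 t, t \in `[0, 1] &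
     forall i, `|q j ord0 i - sigma t ord0 i| <= beta) ->
  d%:R * (2 * h) <= r -> d%:R * (beta + 2 * h) < delta ->
  path_nbhd sigma delta `<=` unit_cube d ->
  (forall sigma', is_path S T sigma' ->
     path_image sigma' `<=` path_nbhd sigma delta -> (bcost M sigma' <= c)%E) ->
  (forall j, (0 < j < K)%N -> exists2 x, V x & corner_cube (q j) a x) ->
  has_good_monotone_path M V r S T c.
Proof.
move=> d0 K0 a0 VS VT q0 qK qstep qsigma hr hdelta cube robust_c hits.
(* [S] and [T] serve as the points of the first and last cubes, being their corners; only inner
   cubes need samples. Beyond [K] the value is a dummy. *)
have y_ex j : exists x, (j <= K)%N ->
    [/\ V x, j = 0%N -> x = S, j = K -> x = T & corner_cube (q j) a x].
  have inq i : corner_cube (q i) a (q i) by move=> k; rewrite lexx ltrDl.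
  have [->|j0] := eqVneq j 0%N.
    exists S; split => //; last by rewrite -q0.
    by move=> K00; rewrite -q0 -qK -K00.
  have [->|jK] := eqVneq j K.
    exists T; split => //; last by rewrite -qK.
    by move=> K00; rewrite -q0 -qK K00.
  have [jK'|] := leqP j K; last by exists S.
  have [|x Vx xq] := hits j; first by rewrite lt0n j0 ltn_neqAle jK.
  exists x => _; split=> //; first by move=> j00; rewrite j00 eqxx in j0.
  by move=> j00; rewrite j00 eqxx in jK.
have [y hy] := boolp.choice y_ex.
have y0 : y 0%N = S by have [] := hy 0%N isT; auto.
have yK : y K = T by have [] := hy K (leqnn K); auto.
(* [y_j < q_j + a <= q_(j+1) <= y_(j+1) < q_(j+1) + a <= q_j + 2h], using [a <= h]. *)
have ystep j : (j < K)%N -> forall i,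
    y j ord0 i < y j.+1 ord0 i /\ q j ord0 i <= y j ord0 i /\
    y j.+1 ord0 i <= q j ord0 i + 2 * h.
  move=> jK i; have [_ _ _ /(_ i) h1] := hy j (ltnW jK).
  by have [_ _ _ /(_ i) h2] := hy j.+1 jK; have := qstep j i jK; lra.
(* The whole edge lies in the box from [q_j] to [q_j + 2h], and [q_j] is within [beta] of [sigma t]
   in each coordinate. *)
have seg_nbhd j : (j < K)%N -> segment (y j) (y j.+1) `<=` path_nbhd sigma delta.
  move=> jK z; rewrite segmentP => -[s]; rewrite /= in_itv /= => s01 <-.
  have [t t01 ht] := qsigma j (ltnW jK).
  exists t => //; rewrite /eball /=.
  apply: le_lt_trans hdelta; apply: edist_le.
    have := ht (Ordinal d0); have := qstep j (Ordinal d0) jK.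
    have := normr_ge0 (q j ord0 (Ordinal d0) - sigma t ord0 (Ordinal d0)); lra.
  move=> i; rewrite !mxE; have := ht i; rewrite !ler_norml.
  have [h1 [h2 h3]] := ystep j jK i.
  set u := y j.+1 _ _ - _ => h4; have : 0 <= s * u <= u.
    by rewrite mulr_ge0 ?ler_piMl /u; lra.
  rewrite /u; lra.
exists (map y (iota 1 K)); rewrite -y0 last_map_iota; split; first exact: yK.
split.
  apply: chain_map_iota => j /= jK; have [Vj _ _ _] := hy j (ltnW jK).
  have [Vj' _ _ _] := hy j.+1 jK; have st := ystep j jK.
  split; last by move=> i; have := st i; lra.
  split=> //; split=> //; split.
    by move=> e; have := st (Ordinal d0); rewrite e; lra.
  apply: le_trans hr; apply: edist_le.
    by have := qstep j (Ordinal d0) jK; lra.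
  by move=> i; have := st i; rewrite ler_norml; lra.
have im_nbhd : poly_image (y 0%N) (map y (iota 1 K)) `<=` path_nbhd sigma delta.
  apply: poly_image_map_iota; last by move=> j jK; apply: seg_nbhd.
  apply: (seg_nbhd _ K0); exists 0; rewrite /= ?in_itv /= ?lexx ?ler01//.
  by rewrite subr0 scale1r scale0r addr0.
have [g [gc g0 g1 gim]] := polyline (y 0%N) (map y (iota 1 K)).
rewrite /bcost_set -gim; apply: robust_c; last by rewrite /path_image gim.
split; first exact: continuous_subspaceT.
split; last by rewrite g0// g1 last_map_iota.
by move=> t t01; apply: cube; apply: im_nbhd; rewrite -gim; exists t.
Qed.

(** * Fixed tolerances, then the limit *)

Lemma good_path_probability {R : realType} {d : nat} (M : 'rV[R]_d -> R)
    (S T : 'rV[R]_d) (sigma : R -> 'rV[R]_d) (delta' delta'' : R)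
    {dO : measure_display} {Omega : measurableType dO} (P : probability Omega R)
    (X : nat -> 'I_d -> Omega -> R) (r : nat -> R) (eps eta : R) :
  (0 < d)%N -> unit_cube d S -> unit_cube d T ->
  robust M S T sigma -> monotone_path sigma ->
  0 < delta' -> path_nbhd sigma delta' `<=` unit_cube d ->
  0 < delta'' <= 1 -> (forall i, delta'' <= T ord0 i - S ord0 i) ->
  iid_uniform_coords P X ->
  (r n / powR (ln n%:R / n%:R) d%:R^-1) @[n --> \oo] --> +oo ->
  0 < eps -> 0 < eta ->
  \forall n \near \oo, exists A : set Omega, [/\ measurable A,
    forall w, A w -> has_good_monotone_path M (vertex_set X n S T w) (r n) S T
      ((1 + eps)%:E * bcost M sigma)%E &
    ((1 - eta)%:E <= P A)%E].
Proof.
move=> d0 S01 T01 [sigma_path robust_cost] mono delta'0 cube /andP[D0 D1] ST hX hr eps0 eta0.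
have [delta1 [delta10 cost1]] := robust_cost _ eps0.
(* One radius serves both purposes: cost control by robustness, and staying inside the unit cube. *)
pose delta := Num.min delta1 delta'.
have delta0 : 0 < delta by rewrite lt_min delta10.
have sub_nbhd rho : delta <= rho -> path_nbhd sigma delta `<=` path_nbhd sigma rho.
  by move=> le z [t t01 zt]; exists t => //; apply: lt_le_trans le.
have dR : 1 <= d%:R :> R by rewrite ler1n.
(* The cap 1 makes [beta] a convex weight; the other term leaves room, as [d * beta] and [d * 2h]
   each cost at most [delta / 4]. *)
pose beta := Num.min 1 (delta / (4 * d%:R)).
have beta0 : 0 < beta by rewrite lt_min ltr01 divr_gt0// mulr_gt0//; lra.
have beta1 : beta <= 1 by rewrite ge_min lexx.
have dbeta : d%:R * beta <= delta / 4.
  apply: (@le_trans _ _ (d%:R * (delta / (4 * d%:R)))).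
    by rewrite ler_pM2l ?ge_min ?lexx ?orbT//; lra.
  by rewrite le_eqVlt; apply/orP; left; apply/eqP; field; lra.
have c01 : 0 < beta * delta'' <= 1 by rewrite mulr_gt0//= mulr_ile1// ltW.
have delta4 : 0 < delta / 4 by rewrite divr_gt0.
(* With step bound [h = d / K], the edge length bound [d * 2h] is [2 d^2 / K], whence this
   numerator. *)
have DD : 0 < d%:R * (2 * d%:R) :> R by rewrite !mulr_gt0//; lra.
have scale := scale_choice d0 hr c01 DD delta4 eta0.
near=> n.
have [K K0 [Kr Kdelta Keta]] : exists2 K : nat, (0 < K)%N &
    [/\ d%:R * (2 * d%:R) / K%:R <= r n, d%:R * (2 * d%:R) / K%:R <= delta / 4 &
        K%:R * (1 - (beta * delta'' / K%:R) ^+ d) ^+ n <= eta].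
  by near: n; exact: scale.
have KR : 1 <= K%:R :> R by rewrite ler1n.
have KR0 : 0 < K%:R :> R by lra.
have beta01 : 0 <= beta <= 1 by rewrite beta1 ltW.
have [q [q0 qK qstep q01 qsigma]] :=
  @waypoints R d S T sigma delta'' beta K d0 sigma_path mono S01 T01 D0 ST beta01 K0.
set a := beta * delta'' / K%:R in qstep Keta.
have a0 : 0 < a by rewrite divr_gt0// mulr_gt0.
have a1 : a <= 1.
  by rewrite ler_pdivrMr// mul1r; case/andP: c01 => _ c1; apply: le_trans KR.
(* The shift selects the [K - 1] inner cubes. Each fits in the unit cube since its upper corner is
   at most the next mark. *)
pose q' j := q j.+1.
have q'01 j k : (j < K.-1)%N -> 0 <= q' j ord0 k /\ q' j ord0 k + a <= 1.
  move=> jK; have jK1 : (j.+1 < K)%N by rewrite -ltn_predRL.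
  have := q01 j.+1 k (ltnW jK1); have := q01 j.+2 k jK1; have := qstep j.+1 k jK1.
  rewrite /q'; lra.
have [mA PA] := hit_all_cubes P hX _ n q' a (ltW a0) q'01.
eexists; split; first exact: mA.
- move=> w Aw.
  apply: (@good_monotone_path_of_cubes _ _ M S T sigma _ (r n) delta beta a (d%:R / K%:R) _ K q) => //.
  + by left.
  + by right; left.
  + by apply: le_trans Kr; rewrite !mulrA.
  + have : d%:R * (2 * (d%:R / K%:R)) <= delta / 4 by apply: le_trans Kdelta; rewrite !mulrA.
    by rewrite mulrDr; lra.
  + by apply: subset_trans cube; apply: sub_nbhd; rewrite ge_min lexx orbT.
  + move=> s' sp im; apply: cost1 => //; apply: subset_trans im _.
    by apply: sub_nbhd; rewrite ge_min lexx.
  + move=> [//|j] /= jK; have jK' : (j < K.-1)%N by rewrite ltn_predRL.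
    have [i iN wi] := Aw j jK'.
    by exists (sample_point X i w) => //; right; right; exists i.
- apply: le_trans PA; rewrite lee_fin lerD2l lerN2; apply: le_trans Keta.
  apply: ler_wpM2r; last by rewrite ler_nat leq_pred.
  by rewrite exprn_ge0// subr_ge0 exprn_ile1// ltW.
Unshelve. all: by end_near. Qed.

Theorem theorem4
  (R : realType) (d : nat) (hd : (2 <= d)%N)
  (M : 'rV[R]_d -> R) (S T : 'rV[R]_d)
  (hS : unit_cube d S) (hT : unit_cube d T)
  (sigma_star : R -> 'rV[R]_d)
  (hopt : robustly_optimal_monotone M S T sigma_star)
  (delta' : R) (hdelta' : 0 < delta')
  (hball : path_nbhd sigma_star delta' `<=` unit_cube d)
  (delta'' : R) (hdelta'' : 0 < delta'' <= 1)
  (hST : preceq_delta delta'' S T)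
  (dO : measure_display) (Omega : measurableType dO) (P : probability Omega R)
  (X : nat -> 'I_d -> Omega -> R)
  (hX : iid_uniform_coords P X)
  (r : nat -> R)
  (hr : (r n / powR (ln n%:R / n%:R) d%:R^-1) @[n --> \oo] --> +oo) :
  exists eps : nat -> R,
    eps @ \oo --> 0 /\
    exists A : nat -> set Omega,
      (forall n, measurable (A n)) /\
      (forall n w, A n w ->
         has_good_monotone_path M (vertex_set X n S T w) (r n) S T
           ((1 + eps n)%:E * bcost M sigma_star)%E) /\
      (P (A n) @[n --> \oo] --> 1%E).
Proof.
have [hrob [hmono _]] := hopt; have [_ [hlow _]] := hST.
(* The harmonic term [1 / (m + 1)] is both the cost tolerance and the failure probability. *)
pose Q m n := exists A : set Omega, [/\ measurable A,
    forall w, A w -> has_good_monotone_path M (vertex_set X n S T w) (r n) S T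
      ((1 + harmonic m)%:E * bcost M sigma_star)%E &
    ((1 - harmonic m)%:E <= P A)%E].
have Qnear m : \forall n \near \oo, Q m n.
  by apply: (@good_path_probability R d M S T sigma_star delta' delta'') => //;
    [exact: ltnW|exact: harmonic_gt0|exact: harmonic_gt0].
have [f [foo Qf]] := diagonal_cvg _ Qnear.
have heps : (harmonic (f n) : R) @[n --> \oo] --> (0 : R).
  exact: cvg_comp foo cvg_harmonic.
(* Where [Q (f n) n] fails, the empty event is taken; this does not affect the limit, since
   [Q (f n) n] holds eventually. *)
have A_ex n : exists A : set Omega, [/\ measurable A,
    forall w, A w -> has_good_monotone_path M (vertex_set X n S T w) (r n) S T
      ((1 + harmonic (f n))%:E * bcost M sigma_star)%E &
    Q (f n) n -> ((1 - harmonic (f n))%:E <= P A)%E].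
  have [[A [mA gA PA]]|nQ] := pselect (Q (f n) n); first by exists A.
  by exists set0; split.
have [A hA] := boolp.choice A_ex.
exists (fun n => harmonic (f n)); split => //.
exists A; split; first by move=> n; case: (hA n).
split; first by move=> n; case: (hA n).
apply: (@squeeze_cvge _ _ _ _ (fun n => (1 - harmonic (f n))%:E) _ (fun=> 1%E)).
- near=> n; have [mA _ h] := hA n; rewrite probability_le1// andbT.
  by apply: h; near: n.
- apply: cvg_EFin; first by near=> n.
  rewrite -[X in _ --> X]subr0; apply: cvgB => //; exact: cvg_cst.
- exact: cvg_cst.
Unshelve. all: by end_near. Qed.
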